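(* Suppose that $\mathcal X$ and $\Xi$ are convex. Then the problem $$\begin{aligned}\min\ &\alpha+\beta\Omega+\frac1M\sum_{m\in[M]}\nu_m\big(\mathbb E_{\hat{\mathbb P}_N}[\ell(z_m,\xi)]+\epsilon\big)\\ \text{s.t. }&x\in\mathcal X,\ \alpha\in\mathbb R,\ \beta\in\mathbb R_+,\ \nu\in\mathbb R_+^M,\\ &\ell(x,\xi)\le\alpha+\beta\|\xi\|^2+\frac1M\sum_{m\in[M]}\nu_m\ell(z_m,\xi)\qquad\forall\xi\in\Xi\end{aligned}$$ is equivalent to the finite convex program $$\begin{aligned}\min\ &\alpha+\beta\Omega+\frac1M\sum_{m\in[M]}\nu_m\big(\mathbb E_{\hat{\mathbb P}_N}[\ell(z_m,\xi)]+\epsilon\big)\\ \text{s.t. }&x\in\mathcal X,\ \alpha\in\mathbb R,\ \beta\in\mathbb R_+,\ \nu\in\mathbb R_+^M,\\ &\lambda_{jm}\in\mathbb R_+^J\ \ \forall j\in[J],\,m\in[M],\quad\theta_j\in\mathbb R^{D_\xi},\ \zeta_j\in\mathbb R_+\ \ \forall j\in[J],\\ &\mathbf e^\top\lambda_{jm}=\nu_m\quad\forall m\in[M],\ \forall j\in[J],\\ &\zeta_j+\sigma_\Xi(\theta_j)+b_j(x)-\frac1M\sum_{m\in[M],k\in[J]}\lambda_{jm}^kb_k(z_m)\le\alpha\quad\forall j\in[J],\\ &\left\|\begin{bmatrix}a_j(x)-\frac1M\sum_{m\in[M],k\in[J]}\lambda_{jm}^ka_k(z_m)-\theta_j\\ \zeta_j-\beta\end{bmatrix}\right\|\le\zeta_j+\beta\quad\forall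 j\in[J].\end{aligned}$$
   Context: $\mathcal X\subseteq\mathbb R^{D_x}$ and $\Xi\subseteq\mathbb R^{D_\xi}$ are compact. The loss is $\ell(x,\xi)=\max_{j\in[J]}\big(a_j(x)^\top\xi+b_j(x)\big)$ with $a_j(x)=\mathbf A_jx+\bar{\mathbf a}_j\in\mathbb R^{D_\xi}$ and $b_j(x)=\mathbf b_j^\top x+\bar b_j$ affine in $x$. $\hat{\mathbb P}_N$ is a reference probability distribution on $\Xi$ with $\mathbb E_{\hat{\mathbb P}_N}[\|\xi\|^2]<\Omega$; $\epsilon\ge0$; $z_1,\dots,z_M\in\mathcal X$ are given sampled points. $\sigma_\Xi(\theta)=\sup_{\xi\in\Xi}\theta^\top\xi$ is the support function, $\mathbf e$ is the all-ones vector, $\lambda_{jm}^k$ is the $k$-th component of $\lambda_{jm}$, and $\|\cdot\|$ is the Euclidean norm. ''Equivalent'' means that $(x,\alpha,\beta,\nu)$ is feasible in the first problem if and only if it can be completed by auxiliary variables $(\lambda,\theta,\zeta)$ to a feasible point of the second (the objectives being identical). *)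

(* Defs.v *)
(* MathComp / MathComp-Analysis. *)
From HB Require Import structures.
From mathcomp Require Import all_boot all_order all_algebra.
From mathcomp Require Import all_classical all_reals all_analysis.
Set Implicit Arguments.
Unset Strict Implicit.
Unset Printing Implicit Defensive.
Import Order.TTheory GRing.Theory Num.Theory.
Import numFieldNormedType.Exports.
Local Open Scope classical_set_scope.
Local Open Scope ring_scope.

Section Euclidean.
Context {R : realType} {D : nat}.
Implicit Types u v : 'cV[R]_D.

Definition dot u v : R := (u^T *m v) 0 0.

(* The library norm `|u| on matrices is the sup norm; this is the Euclidean
   one.  Both induce the library's topology on 'cV[R]_D. *)
Definition enorm u : R := Num.sqrt (dot u u).

(* Real-valued supremum: this is the support function as soon as Xi is
   nonempty and bounded. *)
Definition support_fun (Xi : set 'cV[R]_D) u : R := sup [set dot u xi | xi in Xi].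

End Euclidean.

(* R^D with its Borel sigma-algebra. *)
Definition borel_cV (R : realType) (D : nat) :=
  g_sigma_algebraType (@open 'cV[R]_D).

(* There are J.+1 affine pieces, so that the maximum ranges over a nonempty
   index set. *)
Record max_affine (R : realType) (Dx Dxi J : nat) := MaxAffine {
  slope_mx : 'I_J.+1 -> 'M[R]_(Dxi, Dx);
  slope_cst : 'I_J.+1 -> 'cV[R]_Dxi;
  offset_vec : 'I_J.+1 -> 'cV[R]_Dx;
  offset_cst : 'I_J.+1 -> R }.

Section Loss.
Context {R : realType} {Dx Dxi J : nat} (L : max_affine R Dx Dxi J).

Definition slope (j : 'I_J.+1) (x : 'cV[R]_Dx) : 'cV[R]_Dxi :=
  slope_mx L j *m x + slope_cst L j.

Definition offset (j : 'I_J.+1) (x : 'cV[R]_Dx) : R :=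
  dot (offset_vec L j) x + offset_cst L j.

Definition piece (j : 'I_J.+1) (x : 'cV[R]_Dx) (xi : 'cV[R]_Dxi) : R :=
  dot (slope j x) xi + offset j x.

Definition loss (x : 'cV[R]_Dx) (xi : 'cV[R]_Dxi) : R :=
  \big[Num.max/piece ord0 x xi]_(j < J.+1) piece j x xi.

End Loss.

(* Minimization of [objective] over [feasible]. *)
Record program (R : realType) (V : lmodType R) := Program {
  feasible : set V;
  objective : V -> R }.

Definition convex_program (R : realType) (V : lmodType R) (p : program V) :=
  convex_set (feasible p : set (convex_lmodType V)) /\
  convex_function (feasible p : set (convex_lmodType V)) (objective p).

(* q has the decision variables of p together with auxiliary ones in W. *)
Definition equivalent_by_completion (R : realType) (V W : lmodType R)
    (p : program V) (q : program (V * W)%type) :=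
  (forall v : V, feasible p v <-> exists w : W, feasible q (v, w)) /\
  (forall (v : V) (w : W), objective q (v, w) = objective p v).

(* (x, alpha, beta, nu) *)
Definition decision (R : realType) (Dx M : nat) : lmodType R :=
  ('cV[R]_Dx * R^o * R^o * 'cV[R]_M)%type.

(* (lambda, theta, zeta), with lambda (j, m) k 0 the k-th component of
   lambda_{jm} *)
Definition auxiliary (R : realType) (Dxi J M : nat) : lmodType R :=
  ({ffun 'I_J.+1 * 'I_M -> 'cV[R]_J.+1} * {ffun 'I_J.+1 -> 'cV[R]_Dxi}
    * 'cV[R]_J.+1)%type.

Section Programs.
Context {R : realType} {Dx Dxi J M : nat}.
Variables (X : set 'cV[R]_Dx) (Xi : set 'cV[R]_Dxi).
Variable L : max_affine R Dx Dxi J.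
Variables (P : probability (borel_cV R Dxi) R) (Omega eps : R).
Variable z : 'I_M -> 'cV[R]_Dx.

(* [fine] is harmless: loss L (z m) is continuous, hence bounded on the compact
   set Xi carrying P, so the expectation is finite. *)
Definition cost (v : decision R Dx M) : R :=
  let '(x, alpha, beta, nu) := v in
  alpha + beta * Omega
  + M%:R^-1 * \sum_(m < M) nu m 0 * (fine ('E_P[loss L (z m)])%E + eps).

Definition semi_infinite_program : program (decision R Dx M) :=
  {| feasible := [set v : decision R Dx M | let '(x, alpha, beta, nu) := v in
       [/\ X x,
           0 <= beta,
           forall m, 0 <= nu m 0
         & forall xi, Xi xi ->
             loss L x xi <= alpha + beta * enorm xi ^+ 2
               + M%:R^-1 * \sum_(m < M) nu m 0 * loss L (z m) xi ]];
     objective := cost |}.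

Definition finite_program : program (decision R Dx M * auxiliary R Dxi J M)%type :=
  {| feasible := [set vw : decision R Dx M * auxiliary R Dxi J M |
       let '(x, alpha, beta, nu) := vw.1 in
       let '(lambda, theta, zeta) := vw.2 in
       [/\ [/\ X x, 0 <= beta & forall m, 0 <= nu m 0],
           (forall j m k, 0 <= lambda (j, m) k 0) /\ (forall j, 0 <= zeta j 0),
           forall m j, dot (const_mx 1) (lambda (j, m)) = nu m 0,
           forall j,
             zeta j 0 + support_fun Xi (theta j) + offset L j x
               - M%:R^-1 * (\sum_(m < M) \sum_(k < J.+1)
                              lambda (j, m) k 0 * offset L k (z m))
             <= alpha
         & forall j,
             enorm (col_mx
               (slope L j x
                 - M%:R^-1 *: (\sum_(m < M) \sum_(k < J.+1)
                                 lambda (j, m) k 0 *: slope L k (z m))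
                 - theta j)
               ((zeta j 0 - beta)%:M : 'cV[R]_1))
             <= zeta j 0 + beta ]];
     objective := fun vw => cost vw.1 |}.

End Programs.

(* Main.v *)
Require Import Defs.
From HB Require Import structures.
From mathcomp Require Import all_boot all_order all_algebra.
From mathcomp Require Import all_classical all_reals all_analysis.
From mathcomp Require Import ring lra.
Import Order.TTheory GRing.Theory Num.Theory.
Import numFieldNormedType.Exports.
Local Open Scope classical_set_scope.
Local Open Scope ring_scope.
Set Implicit Arguments.
Unset Strict Implicit.
Unset Printing Implicit Defensive.

(** The semi-infinite constraint splits into one constraint for each affine
    piece j of the loss at x: on Xi,

      piece j x xi <= al + be |xi|^2 + 1/M sum_m nu_m max_k piece k (z m) xi.

    Two dualizations make each of them finite.

    The maxima on the right are replaced by fixed mixtures of the pieces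
    ([piece_multipliers]).  A weighted sum of M maxima is a single maximum over
    the selections s : [M] -> [J] that choose one piece for each m, so the
    constraint says that finitely many convex functions of xi are never
    simultaneously negative on the convex set Xi.  Then some convex combination
    of them is nonnegative on all of Xi ([convex_combination_ge0]): for two
    functions the admissible mixing ratios form an interval whose endpoints
    are compared along segments, and the general case follows by induction.
    The weights on the selections, marginalized at each m and scaled by nu_m,
    are the multipliers lambda_{jm}.  This minimax step uses the convexity of
    Xi but no topology.

    What remains is an inequality c . xi + d <= al + be |xi|^2 on Xi, between
    an affine function and a convex quadratic
    ([affine_le_quadratic_certificate]).  If xs minimizes be |xi|^2 - c . xi
    over the compact set Xi, the first-order condition says that xs also
    maximizes theta . xi over Xi for theta = c - 2 be xs, and then theta and
    zeta = be |xs|^2 satisfy the budget and the cone constraints.  Conversely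
    the cone constraint means |c - theta|^2 <= 4 zeta be, whence
    (c - theta) . xi <= zeta + be |xi|^2 by completing the square, while
    theta . xi is at most the support function.

    The finite program is convex because the decision enters it affinely, except
    through the support function and the Euclidean norm, which are sublinear
    and occur only on the smaller side of inequalities. *)

(** * Euclidean geometry *)

Section EuclideanSpace.
Context {R : realType} {D : nat}.
Implicit Types (u v w : 'cV[R]_D) (a : R).

Lemma dotE u v : dot u v = \sum_i u i 0 * v i 0.
Proof. by rewrite /dot mxE; apply: eq_bigr => i _; rewrite mxE. Qed.

Lemma dotC u v : dot u v = dot v u.
Proof. by rewrite !dotE; apply: eq_bigr => i _; rewrite mulrC. Qed.

Lemma dotDl u v w : dot (u + v) w = dot u w + dot v w.
Proof. by rewrite /dot linearD mulmxDl mxE. Qed.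

Lemma dotZl a u v : dot (a *: u) v = a * dot u v.
Proof. by rewrite /dot linearZ -scalemxAl mxE. Qed.

Lemma dotBl u v w : dot (u - v) w = dot u w - dot v w.
Proof. by rewrite dotDl -scaleN1r dotZl mulN1r. Qed.

Lemma dotDr u v w : dot w (u + v) = dot w u + dot w v.
Proof. by rewrite dotC dotDl !(dotC w). Qed.

Lemma dotZr a u v : dot v (a *: u) = a * dot v u.
Proof. by rewrite dotC dotZl (dotC v). Qed.

Lemma dotBr u v w : dot w (u - v) = dot w u - dot w v.
Proof. by rewrite dotC dotBl !(dotC w). Qed.

Lemma dot_suml I (r : seq I) (F : I -> 'cV[R]_D) v :
  dot (\sum_(i <- r) F i) v = \sum_(i <- r) dot (F i) v.
Proof.
apply: (big_morph (fun u => dot u v)) => [u w|]; first exact: dotDl.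
by rewrite -(scale0r 0) dotZl mul0r.
Qed.

Lemma dot_ge0 u : 0 <= dot u u.
Proof. by rewrite dotE; apply: sumr_ge0 => i _; rewrite -expr2 sqr_ge0. Qed.

Lemma dot_eq0 u : dot u u <= 0 -> u = 0.
Proof.
move=> u0; have {u0} : dot u u = 0 by apply/eqP; rewrite eq_le u0 dot_ge0.
rewrite dotE => /eqP; rewrite psumr_eq0; last first.
  by move=> i _; rewrite -expr2 sqr_ge0.
move=> /allP u0; apply/matrixP => i j; rewrite ord1 mxE.
have /= := u0 i (mem_index_enum i).
by rewrite mulf_eq0 orbb => /eqP.
Qed.

Lemma sqr_enorm u : enorm u ^+ 2 = dot u u.
Proof. by rewrite /enorm sqr_sqrtr // dot_ge0. Qed.

Lemma enorm_ge0 u : 0 <= enorm u.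
Proof. exact: sqrtr_ge0. Qed.

Lemma enorm_le u a : 0 <= a -> (enorm u <= a) = (dot u u <= a ^+ 2).
Proof. by move=> a0; rewrite -sqr_enorm ler_sqr // ?nnegrE // enorm_ge0. Qed.

Lemma enormZ a u : 0 <= a -> enorm (a *: u) = a * enorm u.
Proof.
by move=> a0; rewrite /enorm dotZl dotZr mulrA -expr2 sqrtrM ?sqr_ge0 //
  sqrtr_sqr ger0_norm.
Qed.

(** Outside the degenerate case, expand the squared norm of the vector
    enorm v *: u - enorm u *: v and divide by enorm u * enorm v. *)
Lemma Cauchy_Schwarz u v : dot u v <= enorm u * enorm v.
Proof.
have [|uv0] := leP (enorm u * enorm v) 0.
  rewrite -sqrtrM ?dot_ge0 // => uv.
  have : dot u u * dot v v = 0.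
    apply/eqP; rewrite eq_le mulr_ge0 ?dot_ge0 // andbT leNgt -sqrtr_gt0.
    by rewrite -leNgt.
  move=> /eqP; rewrite mulf_eq0 => /orP[] /eqP e; rewrite e ?mulr0 ?mul0r sqrtr0.
    by rewrite (@dot_eq0 u) ?e // -(scale0r 0) dotZl mul0r.
  by rewrite (@dot_eq0 v) ?e // -(scale0r 0) dotZr mul0r.
have := dot_ge0 (enorm v *: u - enorm u *: v).
rewrite !(dotBl, dotBr, dotZl, dotZr) (dotC v u) -!sqr_enorm => h.
rewrite -(ler_pM2l uv0); nra.
Qed.

Lemma enormD u v : enorm (u + v) <= enorm u + enorm v.
Proof.
rewrite enorm_le ?addr_ge0 ?enorm_ge0 //.
rewrite !(dotDl, dotDr) (dotC v u) -!sqr_enorm.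
have := Cauchy_Schwarz u v; nra.
Qed.

(** The sets under study are compact for the library's topology on matrices, so
    extreme values of inner products are attained once this is known. *)
Lemma continuous_dot (T : topologicalType) (f g : T -> 'cV[R]_D) :
  continuous f -> continuous g -> continuous (fun t => dot (f t) (g t)).
Proof.
move=> cf cg; rewrite (_ : (fun _ => _) = fun t => \sum_i f t i 0 * g t i 0);
  last by apply/funext => t; rewrite dotE.
apply: (continuous_big (op := +%R)) => [|i _ t].
  exact: tvs.add_continuous.
apply: cvgM.
- exact: (continuous_comp (cf t) (@coord_continuous R D 1 i 0 (f t))).
- exact: (continuous_comp (cg t) (@coord_continuous R D 1 i 0 (g t))).
Qed.

Lemma dotl_continuous u : continuous (dot u).
Proof.
apply: (@continuous_dot _ (fun=> u) id); first exact: cst_continuous.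
by move=> v; exact: cvg_id.
Qed.

Lemma dot_self_continuous : continuous (fun u => dot u u).
Proof. by apply: (@continuous_dot _ id id) => v; exact: cvg_id. Qed.

Lemma dot_col_mx u a :
  dot (col_mx u (a%:M : 'cV[R]_1)) (col_mx u (a%:M : 'cV[R]_1))
    = dot u u + a ^+ 2.
Proof.
rewrite /dot tr_col_mx mul_row_col mxE; congr (_ + _).
by rewrite tr_scalar_mx -scalar_mxM !mxE /= mulr1n expr2.
Qed.

End EuclideanSpace.

(** * Convex functions that are never simultaneously negative *)

Section Convexity.
Context {R : realType} {E : lmodType R}.
Implicit Types (C : set (convex_lmodType E)) (f g : convex_lmodType E -> R^o).

Lemma convex_setE C : convex_set C <->
  forall (t : R) (x y : E), 0 <= t -> t <= 1 -> C x -> C y ->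
    C (t *: x + (1 - t) *: y).
Proof.
split=> [cC t x y t0 t1 Cx Cy|cC x y t].
  by have := cC x y (Itv01 t0 t1); rewrite !inE; apply.
by rewrite !inE => Cx Cy; exact: cC.
Qed.

Lemma convex_functionE C f : convex_function C f <->
  forall (t : R) (x y : E), 0 <= t -> t <= 1 -> C x -> C y ->
    f (t *: x + (1 - t) *: y) <= t * f x + (1 - t) * f y.
Proof.
split=> [cf t x y t0 t1 Cx Cy|cf t x y].
  by have := cf (Itv01 t0 t1) x y; rewrite !inE; apply.
by rewrite !inE => Cx Cy; exact: cf.
Qed.

Lemma convex_sum I (r : seq I) (w : I -> R) (f : I -> convex_lmodType E -> R^o) C :
  (forall i, 0 <= w i) -> (forall i, convex_function C (f i)) ->
  convex_function C (fun x => \sum_(i <- r) w i * f i x).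
Proof.
move=> w0 cf; apply/convex_functionE => t x y t0 t1 Cx Cy.
rewrite !mulr_sumr -big_split /=; apply: ler_sum => i _.
rewrite [_ * (w i * _)]mulrCA [(1 - t) * _]mulrCA -mulrDr ler_wpM2l //.
exact: (proj1 (convex_functionE _ _) (cf i)).
Qed.

(** A ratio f : g violating this inequality would let both convexity bounds be
    negative at one and the same point of the segment from x to y. *)
Lemma cross_mul_le C f g x y :
  convex_set C -> convex_function C f -> convex_function C g ->
  (forall x, C x -> 0 <= f x \/ 0 <= g x) ->
  C x -> C y -> f x < 0 -> g y < 0 -> f x * g y <= g x * f y.
Proof.
move=> /convex_setE cC /convex_functionE cf /convex_functionE cg fg Cx Cy fx gy.
have gx : 0 <= g x by case: (fg x Cx) => //; rewrite leNgt fx.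
have fy : 0 <= f y by case: (fg y Cy) => //; rewrite [in 0 <= g y]leNgt gy.
rewrite leNgt; apply/negP => lt_cross.
(* The weights c and d make both convexity bounds negative multiples of the
   gap f x * g y - g x * f y. *)
pose c := f y - g y; pose d := g x - f x.
have c0 : 0 < c by rewrite /c; lra.
have d0 : 0 < d by rewrite /d; lra.
pose t := c / (c + d).
have t0 : 0 <= t by rewrite /t divr_ge0; lra.
have t1 : t <= 1 by rewrite /t ler_pdivrMr; lra.
have neg a b : c * a + d * b < 0 -> t * a + (1 - t) * b < 0.
  rewrite (_ : t * a + _ = (c * a + d * b) / (c + d)); last by rewrite /t; field; lra.
  by move=> n0; rewrite pmulr_llt0 // invr_gt0; lra.
have hf : t * f x + (1 - t) * f y < 0 by apply: neg; rewrite /c /d; lra.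
have hg : t * g x + (1 - t) * g y < 0 by apply: neg; rewrite /c /d; lra.
by case: (fg _ (cC t x y t0 t1 Cx Cy)); rewrite leNgt;
  rewrite ?(le_lt_trans (cf t x y t0 t1 Cx Cy) hf)
          ?(le_lt_trans (cg t x y t0 t1 Cx Cy) hg).
Qed.

(** A point where g < 0 bounds the weight of f from below, and a point where
    f < 0 bounds it from above; [cross_mul_le] says that every lower bound is at
    most every upper bound, so the supremum of the lower bounds will do. *)
Lemma convex_combination2_ge0 C f g :
  convex_set C -> convex_function C f -> convex_function C g ->
  (forall x, C x -> 0 <= f x \/ 0 <= g x) ->
  exists t, [/\ 0 <= t, t <= 1 &
    forall x, C x -> 0 <= t * f x + (1 - t) * g x].
Proof.
move=> cC cf cg fg.
pose S := [set 0 : R] `|` [set g y / (g y - f y) | y in [set y | C y /\ g y < 0]].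
have fpos y : C y -> g y < 0 -> 0 <= f y.
  by move=> Cy gy; case: (fg y Cy) => //; rewrite [in 0 <= g y]leNgt gy.
have gpos y : C y -> f y < 0 -> 0 <= g y.
  by move=> Cy fy; case: (fg y Cy) => //; rewrite [in 0 <= f y]leNgt fy.
have S1 : ubound S 1.
  move=> _ [->|[y [Cy gy] <-]] //; have fy := fpos y Cy gy.
  by rewrite ler_ndivrMr; lra.
have S0 : S !=set0 by exists 0; left.
have [t St tS] : exists2 t, ubound S t & forall u, ubound S u -> t <= u.
  exists (sup S) => u; first by move=> Su; apply: ub_le_sup => //; exists 1.
  by move=> Su; apply: ge_sup.
have t0 : 0 <= t by apply: St; left.
have t1 : t <= 1 by apply: tS.
exists t; split=> // x Cx; have [gx|gx] := ltP (g x) 0.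
  have fx := fpos x Cx gx.
  have : g x / (g x - f x) <= t by apply: St; right; exists x.
  by rewrite ler_ndivrMr; lra.
have [fx|fx] := ltP (f x) 0; last first.
  by rewrite addr_ge0 // mulr_ge0 // subr_ge0.
have : t <= g x / (g x - f x).
  apply: tS => _ [->|[y [Cy gy] <-]]; first by rewrite divr_ge0; lra.
  have fy := fpos y Cy gy.
  have cross := cross_mul_le cC cf cg fg Cx Cy fx gy.
  have dx : 0 < g x - f x by lra.
  have dy : g y - f y < 0 by lra.
  by rewrite ler_pdivlMr // mulrAC ler_ndivrMr //; lra.
by rewrite ler_pdivlMr; lra.
Qed.

(** Induction on the family: wherever f i is negative, the others are never
    simultaneously negative, and the induction hypothesis on that convex subset
    merges them into one function, to be combined with f i over the whole of
    C. *)
Lemma convex_combination_ge0 (I : eqType) (s : seq I)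
    (f : I -> convex_lmodType E -> R^o) C :
  uniq s -> convex_set C -> C !=set0 -> (forall i, convex_function C (f i)) ->
  (forall x, C x -> exists2 i, i \in s & 0 <= f i x) ->
  exists w : I -> R, [/\ forall i, 0 <= w i, \sum_(i <- s) w i = 1 &
    forall x, C x -> 0 <= \sum_(i <- s) w i * f i x].
Proof.
move=> + + + cf.
elim: s C cf => [|i s IH] C cf.
  by move=> _ _ [x Cx] /(_ x Cx) [].
move=> /= /andP[i_s us] cC C0 maxf.
(* weight t on i and the remaining mass distributed according to w *)
have mix (w : I -> R) (t : R) (F : I -> R) :
    \sum_(k <- i :: s) (if k == i then t else (1 - t) * w k) * F k
    = t * F i + (1 - t) * \sum_(k <- s) w k * F k.
  rewrite big_cons eqxx mulr_sumr; congr (_ + _).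
  apply: eq_big_seq => k ks; rewrite ifN ?mulrA //.
  by apply: contraNneq i_s => <-.
pose Ci := [set x : convex_lmodType E | C x /\ f i x < 0].
have cCi : convex_set Ci.
  apply/convex_setE => t x y t0 t1 [Cx fx] [Cy fy]; split.
    exact: (proj1 (convex_setE _) cC).
  apply: le_lt_trans (proj1 (convex_functionE _ _) (cf i) _ _ _ t0 t1 Cx Cy) _.
  nra.
have [[x0 Ci0]|/set0P/negP/negPn/eqP Ci0] := pselect (Ci !=set0).
  have cfi k : convex_function Ci (f k).
    apply/convex_functionE => t x y t0 t1 [Cx _] [Cy _].
    exact: (proj1 (convex_functionE _ _) (cf k)).
  have [|w [w0 w1 wf]] := IH Ci cfi us cCi (ex_intro _ x0 Ci0).
    move=> x [Cx fx]; have [k] := maxf x Cx.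
    rewrite inE => /orP[/eqP->|]; first by rewrite leNgt fx.
    by exists k.
  have [x Cx|t [t0 t1 tf]] :=
    convex_combination2_ge0 cC (cf i) (convex_sum s w0 cf).
    by have [fx|] := ltP (f i x) 0; [right; apply: wf|left].
  exists (fun k => if k == i then t else (1 - t) * w k); split.
  - by move=> k; case: ifP => // _; rewrite mulr_ge0 // subr_ge0.
  - transitivity (t * 1 + (1 - t) * \sum_(k <- s) w k * 1).
      by rewrite -(mix w t (fun=> 1)); apply: eq_bigr => k _; rewrite mulr1.
    by rewrite -mulr_suml w1; ring.
  - by move=> x Cx; rewrite mix tf.
(* f i is nowhere negative on C and takes all the weight; the zero weight is
   written so as to be an instance of mix. *)
exists (fun k => if k == i then 1 else (1 - 1) * 0); split.
- by move=> k; case: ifP => // _; rewrite mulr0.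
- transitivity (1 * 1 + (1 - 1) * \sum_(k <- s) 0 * 1 : R).
    by rewrite -(mix (fun=> 0) 1 (fun=> 1)); apply: eq_bigr => k _; rewrite mulr1.
  by ring.
- move=> x Cx; rewrite mix subrr mul0r addr0 mul1r leNgt; apply/negP => fx.
  by have : Ci x by []; rewrite Ci0.
Qed.

End Convexity.

(** The hypothesis is that h x + \sum_m nu m * max_k p m k x is nonnegative on C,
    with the maxima expressed by a selection s.  It is a statement about the
    finite family of convex functions indexed by the selections; multipliers
    for the individual p m k are marginals of the weights on selections. *)
Lemma convex_combination_max_ge0 (R : realType) (E : lmodType R) (M K : finType)
    (C : set (convex_lmodType E)) (h : convex_lmodType E -> R^o)
    (nu : M -> R) (p : M -> K -> convex_lmodType E -> R^o) :
  convex_set C -> C !=set0 -> convex_function C h ->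
  (forall m k, convex_function C (p m k)) -> (forall m, 0 <= nu m) ->
  (forall x, C x -> exists s : {ffun M -> K},
     0 <= h x + \sum_m nu m * p m (s m) x) ->
  exists lam : M -> K -> R, [/\ forall m k, 0 <= lam m k,
    forall m, \sum_k lam m k = nu m &
    forall x, C x -> 0 <= h x + \sum_m \sum_k lam m k * p m k x].
Proof.
move=> cC C0 /convex_functionE ch cp nu0 hmax.
pose F (s : {ffun M -> K}) : convex_lmodType E -> R^o :=
  fun x => h x + \sum_m nu m * p m (s m) x.
have cF s : convex_function C (F s).
  have /convex_functionE cs :=
    convex_sum (index_enum M) nu0 (fun m => cp m (s m)).
  apply/convex_functionE => t x y t0 t1 Cx Cy; rewrite /F.
  apply: le_trans (lerD (ch t x y t0 t1 Cx Cy) (cs t x y t0 t1 Cx Cy)) _.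
  by rewrite le_eqVlt; apply/orP; left; apply/eqP; ring.
have [|w [w0 w1 wF]] :=
    convex_combination_ge0 (index_enum_uniq {ffun M -> K}) cC C0 cF.
  by move=> x Cx; have [s hs] := hmax x Cx; exists s; first exact: mem_index_enum.
(* the total weight of the selections that pick piece k for the m-th maximum *)
exists (fun m k => nu m * \sum_(s : {ffun M -> K} | s m == k) w s); split.
- by move=> m k; rewrite mulr_ge0 // sumr_ge0.
- move=> m; rewrite -mulr_sumr -[RHS]mulr1 -w1; congr (_ * _).
  by rewrite (partition_big (fun s : {ffun M -> K} => s m) xpredT).
- move=> x Cx; have := wF x Cx; rewrite /F.
  under eq_bigr do rewrite mulrDr.
  rewrite big_split -mulr_suml w1 mul1r /=.
  congr (_ <= _ + _); under eq_bigr do rewrite mulr_sumr.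
  rewrite exchange_big; apply: eq_bigr => m _.
  rewrite (partition_big (fun s : {ffun M -> K} => s m) xpredT) //=.
  apply: eq_bigr => k _; rewrite mulrAC mulr_sumr.
  by apply: eq_bigr => s /eqP ->; ring.
Qed.

(** * Affine minorants of a convex quadratic on a compact convex set *)

Section QuadraticDuality.
Context {R : realType} {D : nat}.
Implicit Types (Xi : set 'cV[R]_D) (c u th xi : 'cV[R]_D) (al be d ze : R).

Lemma dot_le_support_fun Xi u xi :
  compact Xi -> Xi xi -> dot u xi <= support_fun Xi u.
Proof.
move=> cXi Xxi.
have [|s sXi smax] := @compact_EVT_max _ R (dot u) Xi (ex_intro _ xi Xxi) cXi.
  exact/continuous_subspaceT/dotl_continuous.
apply: ub_le_sup; last by exists xi.
by exists (dot u s) => _ [v Xv <-]; apply: smax; rewrite inE.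
Qed.

Lemma support_fun_le Xi u a :
  Xi !=set0 -> (forall xi, Xi xi -> dot u xi <= a) -> support_fun Xi u <= a.
Proof.
move=> [v Xv] ua; apply: ge_sup; first by exists (dot u v), v.
by move=> _ [xi Xxi <-]; apply: ua.
Qed.

Lemma convex_sqr_enorm Xi be : 0 <= be ->
  convex_function (Xi : set (convex_lmodType 'cV[R]_D))
    (fun xi : 'cV[R]_D => be * enorm xi ^+ 2).
Proof.
move=> be0; apply/convex_functionE => t x y t0 t1 _ _.
rewrite !sqr_enorm !(dotDl, dotDr, dotZl, dotZr) (dotC y x).
have := dot_ge0 (x - y); rewrite !(dotBl, dotBr) (dotC y x) => h.
have : 0 <= be * (t * (1 - t)) * (dot x x - dot x y - (dot x y - dot y y)).
  by rewrite !mulr_ge0 // subr_ge0.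
lra.
Qed.

(** Otherwise moving from xs towards xi would lower the quadratic: its
    derivative at xs in that direction is minus the difference of the two
    sides. *)
Lemma quadratic_min_first_order Xi be c xs xi :
  convex_set (Xi : set (convex_lmodType 'cV[R]_D)) -> 0 <= be ->
  Xi xs -> Xi xi ->
  (forall v, Xi v ->
     be * dot xs xs - dot c xs <= be * dot v v - dot c v) ->
  dot (c - (2 * be) *: xs) xi <= dot (c - (2 * be) *: xs) xs.
Proof.
move=> /convex_setE cXi be0 Xs Xxi smin; rewrite leNgt; apply/negP => lt_s.
have E (w : 'cV[R]_D) (s : R) : be * dot (xs + s *: w) (xs + s *: w) - dot c (xs + s *: w)
    = be * dot xs xs - dot c xs
      - s * (dot (c - (2 * be) *: xs) w - s * (be * dot w w)).
  rewrite dotBl !(dotDl, dotDr, dotZl, dotZr) (dotC w xs); ring.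
pose h := xi - xs.
pose q := dot (c - (2 * be) *: xs) h.
have q0 : 0 < q by rewrite /q /h dotBr subr_gt0.
pose b := be * dot h h.
have b0 : 0 <= b by rewrite mulr_ge0 ?dot_ge0.
(* Along xs + t h the objective changes by - t q + t^2 b, which is negative
   at this t. *)
pose t := q / (b + q).
have t0 : 0 < t by rewrite /t divr_gt0; lra.
have t1 : t <= 1 by rewrite /t ler_pdivrMr; lra.
have := smin _ (cXi t xi xs (ltW t0) t1 Xxi Xs).
rewrite (_ : t *: xi + (1 - t) *: xs = xs + t *: h); last first.
  by rewrite /h scalerBr scalerBl scale1r [RHS]addrCA.
rewrite E -/q -/b; have : 0 < t * (q - t * b); last by lra.
have -> : q - t * b = q * t by rewrite /t; field; lra.
by rewrite mulr_gt0 // mulr_gt0.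
Qed.

(** The second-order cone constraint is the rotated cone
    |u|^2 <= 4 ze be, since (ze + be)^2 - (ze - be)^2 = 4 ze be. *)
Lemma rotated_cone u ze be : 0 <= ze -> 0 <= be ->
  (enorm (col_mx u ((ze - be)%:M : 'cV[R]_1)) <= ze + be)
    = (dot u u <= 4 * ze * be).
Proof.
move=> ze0 be0; rewrite enorm_le ?addr_ge0 // dot_col_mx.
by apply/idP/idP; lra.
Qed.

(** Conic duality for one affine inequality, with the dual solution read off a
    minimizer xs of the quadratic minus the affine function: th is the part of
    c whose maximum over Xi is reached at xs, and ze makes c - th satisfy the
    cone constraint with equality. *)
Lemma affine_le_quadratic_certificate Xi c d al be :
  compact Xi -> convex_set (Xi : set (convex_lmodType 'cV[R]_D)) ->
  Xi !=set0 -> 0 <= be ->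
  (forall xi, Xi xi -> dot c xi + d <= al + be * enorm xi ^+ 2) <->
  exists th ze, [/\ 0 <= ze, ze + support_fun Xi th + d <= al &
    enorm (col_mx (c - th) ((ze - be)%:M : 'cV[R]_1)) <= ze + be].
Proof.
move=> kXi cXi Xi0 be0; split=> [le_q|[th [ze [ze0 le_al]]] + xi Xxi].
- have [|xs] := @compact_EVT_min _ R (fun v => be * dot v v - dot c v) Xi Xi0 kXi.
    apply: continuous_subspaceT => v.
    exact: (cvgB (cvgM (cvg_cst be) (@dot_self_continuous R D v))
      (@dotl_continuous R D c v)).
  rewrite inE => Xs smin.
  have ze0 : 0 <= be * dot xs xs by rewrite mulr_ge0 ?dot_ge0.
  exists (c - (2 * be) *: xs), (be * dot xs xs); split=> //.
  + have : support_fun Xi (c - (2 * be) *: xs) <= dot (c - (2 * be) *: xs) xs.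
      apply: support_fun_le => // xi Xxi.
      apply: (quadratic_min_first_order cXi) => // v Xv.
      by apply: smin; rewrite inE.
    have := le_q xs Xs; rewrite sqr_enorm dotBl dotZl; lra.
  + rewrite rotated_cone // subKr dotZl dotZr le_eqVlt; apply/orP; left.
    by apply/eqP; ring.
- rewrite rotated_cone // => cone.
  have := dot_le_support_fun th kXi Xxi.
  suff : dot (c - th) xi <= ze + be * enorm xi ^+ 2 by rewrite dotBl; lra.
  (* |c - th - 2 be xi|^2 >= 0 gives the bound after division by 4 be; at be = 0
     the cone constraint forces c = th instead. *)
  rewrite sqr_enorm; have [be_gt0|be_le0] := ltP 0 be; last first.
    have be_eq0 : be = 0 by apply/eqP; rewrite eq_le be_le0.
    rewrite (@dot_eq0 _ _ (c - th)); last by rewrite be_eq0 mulr0 in cone.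
    by rewrite -(scale0r 0) dotZl mul0r addr_ge0 // mulr_ge0 // dot_ge0.
  move: (c - th) cone => u cone.
  have := dot_ge0 (u - (2 * be) *: xi).
  rewrite !(dotBl, dotBr, dotZl, dotZr) (dotC xi) => h.
  by rewrite -(ler_pM2l be_gt0); lra.
Qed.

End QuadraticDuality.

(** * The max-affine loss *)

Section Loss.
Context {R : realType} {Dx Dxi J : nat} (L : max_affine R Dx Dxi J).

Lemma piece_le_loss k x xi : piece L k x xi <= loss L x xi.
Proof. exact: le_bigmax. Qed.

Lemma loss_attained x xi : exists k, loss L x xi = piece L k x xi.
Proof.
rewrite /loss; elim/big_ind: _ => [|a b [i ->] [j ->]|k _].
- by exists ord0.
- by rewrite /Num.max; case: ifP => _; [exists j|exists i].
- by exists k.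
Qed.

Lemma piece_conv k x (t : R) (xi xi' : 'cV[R]_Dxi) :
  piece L k x (t *: xi + (1 - t) *: xi')
    = t * piece L k x xi + (1 - t) * piece L k x xi'.
Proof. by rewrite /piece dotDr !dotZr; ring. Qed.

Lemma slope_conv k (t : R) (x y : 'cV[R]_Dx) :
  slope L k (t *: x + (1 - t) *: y)
    = t *: slope L k x + (1 - t) *: slope L k y.
Proof.
rewrite /slope mulmxDr -!scalemxAr !scalerDr addrACA -scalerDl.
by rewrite [t + _]addrC subrK scale1r.
Qed.

Lemma offset_conv k (t : R) (x y : 'cV[R]_Dx) :
  offset L k (t *: x + (1 - t) *: y)
    = t * offset L k x + (1 - t) * offset L k y.
Proof. by rewrite /offset dotDr !dotZr; ring. Qed.

(** For fixed multipliers the constraint on piece j is an affine inequality in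
    xi, whose slope and intercept are the expressions in the finite program. *)
Lemma piece_residual M (lam : 'I_M -> 'I_J.+1 -> R) (z : 'I_M -> 'cV[R]_Dx)
    (a : R) j x xi :
  dot (slope L j x - a *: (\sum_m \sum_k lam m k *: slope L k (z m))) xi
    + (offset L j x - a * (\sum_m \sum_k lam m k * offset L k (z m)))
  = piece L j x xi - a * (\sum_m \sum_k lam m k * piece L k (z m) xi).
Proof.
rewrite dotBl dotZl dot_suml.
have -> : \sum_m \sum_k lam m k * piece L k (z m) xi
    = \sum_m dot (\sum_k lam m k *: slope L k (z m)) xi
      + \sum_m \sum_k lam m k * offset L k (z m).
  rewrite -big_split; apply: eq_bigr => m _.
  rewrite dot_suml -big_split; apply: eq_bigr => k _.
  by rewrite dotZl /piece mulrDr.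
by rewrite /piece; ring.
Qed.

End Loss.

Lemma dot_const1 (R : realType) n (u : 'cV[R]_n) :
  dot (const_mx 1) u = \sum_i u i 0.
Proof. by rewrite dotE; apply: eq_bigr => i _; rewrite mxE mul1r. Qed.

(** * Equivalence and convexity of the programs *)

Section Equivalence.
Context {R : realType} {Dx Dxi J M : nat}.
Context (X : set 'cV[R]_Dx) (Xi : set 'cV[R]_Dxi).
Context (L : max_affine R Dx Dxi J).
Context (P : probability (borel_cV R Dxi) R) (Omega eps : R).
Context (z : 'I_M -> 'cV[R]_Dx).

Context (kXi : compact Xi).
Context (cXi : convex_set (Xi : set (convex_lmodType 'cV[R]_Dxi))).
Context (Xi0 : Xi !=set0).

(** The quadratic term makes the difference of the two sides convex in xi, which
    is what allows the maxima hidden in the losses to be replaced by fixed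
    mixtures of pieces. *)
Lemma piece_multipliers j x (al be : R) (nu : 'I_M -> R) :
  0 <= be -> (forall m, 0 <= nu m) ->
  (forall xi, Xi xi -> piece L j x xi <=
     al + be * enorm xi ^+ 2 + M%:R^-1 * \sum_m nu m * loss L (z m) xi) ->
  exists lam : 'I_M -> 'I_J.+1 -> R, [/\ forall m k, 0 <= lam m k,
    forall m, \sum_k lam m k = nu m &
    forall xi, Xi xi ->
      piece L j x xi - M%:R^-1 * (\sum_m \sum_k lam m k * piece L k (z m) xi)
        <= al + be * enorm xi ^+ 2].
Proof.
move=> be0 nu0 le_loss.
pose h (xi : convex_lmodType 'cV[R]_Dxi) : R^o :=
  be * enorm (xi : 'cV[R]_Dxi) ^+ 2 + (al - piece L j x xi).
pose p m k (xi : convex_lmodType 'cV[R]_Dxi) : R^o :=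
  M%:R^-1 * piece L k (z m) xi.
have ch : convex_function (Xi : set (convex_lmodType 'cV[R]_Dxi)) h.
  apply/convex_functionE => t u v t0 t1 Xu Xv; rewrite /h piece_conv.
  have /convex_functionE cq := @convex_sqr_enorm _ _ Xi be be0.
  have := cq t u v t0 t1 Xu Xv; rewrite /= => hq; lra.
have cp m k : convex_function (Xi : set (convex_lmodType 'cV[R]_Dxi)) (p m k).
  by apply/convex_functionE => t u v _ _ _ _; rewrite /p piece_conv; lra.
(* The factor 1/M is carried by the functions p, so that the multipliers of the
   m-th maximum sum to nu m. *)
have [xi Xxi|lam [lam0 lam1 lamp]] :=
  convex_combination_max_ge0 cXi Xi0 ch cp nu0.
  have [s sE] : exists s : {ffun 'I_M -> 'I_J.+1},
      forall m, loss L (z m) xi = piece L (s m) (z m) xi.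
    have [s sE] := choice (fun m => loss_attained L (z m) xi).
    by exists (finfun s) => m; rewrite ffunE.
  exists s; have := le_loss xi Xxi; rewrite mulr_sumr /h /p.
  under eq_bigr do rewrite sE mulrCA.
  lra.
exists lam; split=> // xi Xxi; have := lamp xi Xxi.
rewrite /h /p mulr_sumr; under eq_bigr do under eq_bigr do rewrite mulrCA.
under [in X in _ -> _ - X <= _]eq_bigr do rewrite mulr_sumr.
lra.
Qed.

(** Both directions treat each piece j separately: [piece_multipliers] yields
    the lambda_{jm} and [affine_le_quadratic_certificate] the theta_j and
    zeta_j.  Conversely a mixture of pieces never exceeds their maximum. *)
Lemma feasible_completion (v : decision R Dx M) :
  feasible (semi_infinite_program X Xi L P Omega eps z) v <->
  exists w, feasible (finite_program X Xi L P Omega eps z) (v, w).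
Proof.
case: v => [[[x al] be] nu] /=; split.
- move=> [Xx be0 nu0 le_loss].
  have /choice[lam lamP] : forall j : 'I_J.+1, exists lam : 'I_M -> 'I_J.+1 -> R,
    [/\ forall m k, 0 <= lam m k, forall m, \sum_k lam m k = nu m 0 &
    forall xi, Xi xi ->
      piece L j x xi - M%:R^-1 * (\sum_m \sum_k lam m k * piece L k (z m) xi)
        <= al + be * enorm xi ^+ 2].
    move=> j; apply: piece_multipliers => // xi Xxi.
    by apply: le_trans (le_loss xi Xxi); exact: piece_le_loss.
  have /choice[th /choice[ze certP]] : forall j, exists th ze,
     [/\ 0 <= ze,
        ze + support_fun Xi th + (offset L j x - M%:R^-1 *
          (\sum_m \sum_k lam j m k * offset L k (z m))) <= al &
        enorm (col_mx (slope L j x - M%:R^-1 *: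
          (\sum_m \sum_k lam j m k *: slope L k (z m)) - th)
          ((ze - be)%:M : 'cV[R]_1)) <= ze + be].
    move=> j; apply/affine_le_quadratic_certificate => // xi Xxi.
    by rewrite piece_residual; case: (lamP j) => _ _; apply.
  exists ([ffun jm : 'I_J.+1 * 'I_M => \col_k lam jm.1 jm.2 k],
          [ffun j => th j], \col_j ze j).
  split; [by []|split| | |].
  + by move=> j m k; rewrite ffunE mxE; case: (lamP j).
  + by move=> j; rewrite mxE; case: (certP j).
  + move=> m j; rewrite dot_const1; case: (lamP j) => _ <- _.
    by apply: eq_bigr => k _; rewrite ffunE mxE.
  + move=> j; case: (certP j) => _ + _; rewrite addrA ffunE mxE.
    by under [in X in _ -> X]eq_bigr do under eq_bigr do rewrite ffunE mxE.
  + move=> j; case: (certP j) => _ _; rewrite ffunE mxE.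
    by under [in X in _ -> X]eq_bigr do under eq_bigr do rewrite ffunE mxE.
- move=> [[[lam th] ze]] [[Xx be0 nu0] [lam0 ze0] lam1 budget cone].
  split=> // xi Xxi; have [j ->] := loss_attained L x xi.
  have le_q : dot (slope L j x - M%:R^-1 *: \sum_m \sum_k
        lam (j, m) k 0 *: slope L k (z m)) xi
      + (offset L j x - M%:R^-1 *
        \sum_m \sum_k lam (j, m) k 0 * offset L k (z m))
      <= al + be * enorm xi ^+ 2.
    move: xi Xxi; apply/affine_le_quadratic_certificate => //.
    by exists (th j), (ze j 0); split=> //; rewrite addrA.
  rewrite piece_residual lerBlDr in le_q; apply: le_trans le_q _.
  rewrite lerD2l ler_wpM2l // ?invr_ge0 //; apply: ler_sum => m _.
  rewrite -(lam1 m j) dot_const1 mulr_suml; apply: ler_sum => k _.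
  by rewrite ler_wpM2l // piece_le_loss.
Qed.

Lemma cost_conv t (v v' : decision R Dx M) :
  cost L P Omega eps z (t *: v + (1 - t) *: v')
  = t * cost L P Omega eps z v + (1 - t) * cost L P Omega eps z v'.
Proof.
case: v v' => [[[x al] be] nu] [[[x' al'] be'] nu'] /=.
rewrite /cost /=.
under eq_bigr do rewrite !mxE mulrDl -2!mulrA.
by rewrite big_split -!mulr_sumr /= /GRing.scale /=; ring.
Qed.

Lemma support_fun_conv (t : R) u v : 0 <= t -> t <= 1 ->
  support_fun Xi (t *: u + (1 - t) *: v)
    <= t * support_fun Xi u + (1 - t) * support_fun Xi v.
Proof.
move=> t0 t1; apply: support_fun_le => // xi Xxi; rewrite dotDl !dotZl.
by apply: lerD; rewrite ler_wpM2l ?subr_ge0 // dot_le_support_fun.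
Qed.

Lemma finite_program_convex :
  convex_set (X : set (convex_lmodType 'cV[R]_Dx)) ->
  convex_program (finite_program X Xi L P Omega eps z).
Proof.
move=> /convex_setE cX; split; last first.
  by apply/convex_functionE => t v w _ _ _ _; rewrite le_eqVlt;
    apply/orP; left; exact/eqP/(cost_conv t v.1 w.1).
apply/convex_setE => t.
move=> [[[[x al] be] nu] [[lam th] ze]] [[[[x' al'] be'] nu'] [[lam' th'] ze']].
move=> t0 t1 [[/= Xx be0 nu0] [lam0 ze0] lam1 budget cone].
move=> [[/= Xx' be0' nu0'] [lam0' ze0'] lam1' budget' cone'].
have s0 : 0 <= 1 - t by rewrite subr_ge0.
split=> /=; [split|split| | |].
- exact: cX.
- by rewrite addr_ge0 // mulr_ge0.
- by move=> m; rewrite !mxE addr_ge0 // mulr_ge0.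
- by move=> j m k; rewrite !ffunE !mxE addr_ge0 // mulr_ge0.
- by move=> j; rewrite !mxE addr_ge0 // mulr_ge0.
- by move=> m j; rewrite !ffunE dotDr !dotZr lam1 lam1' !mxE.
- move=> j; rewrite !ffunE !mxE offset_conv.
  under eq_bigr do under eq_bigr do rewrite !ffunE !mxE mulrDl -2!mulrA.
  under eq_bigr do rewrite big_split -!mulr_sumr.
  rewrite big_split -!mulr_sumr /=.
  have := support_fun_conv (th j) (th' j) t0 t1.
  have := ler_wpM2l t0 (budget j); have := ler_wpM2l s0 (budget' j).
  rewrite /GRing.scale /=; lra.
- move=> j; rewrite !ffunE !mxE slope_conv.
  under eq_bigr do under eq_bigr do rewrite !ffunE !mxE scalerDl -2!scalerA.
  under eq_bigr do rewrite big_split -!scaler_sumr.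
  rewrite big_split -!scaler_sumr /=.
  (* The stacked vector is a linear function of the decision. *)
  have lin (a b c a' b' c' : 'cV[R]_Dxi) (r q q' p p' : R) :
      col_mx (t *: a + (1 - t) *: a' - r *: (t *: b + (1 - t) *: b')
          - (t *: c + (1 - t) *: c'))
        ((t *: (q : R^o) + (1 - t) *: (q' : R^o)
          - (t *: (p : R^o) + (1 - t) *: (p' : R^o)))%:M : 'cV[R]_1)
      = t *: col_mx (a - r *: b - c) ((q - p)%:M : 'cV[R]_1)
        + (1 - t) *: col_mx (a' - r *: b' - c') ((q' - p')%:M : 'cV[R]_1).
    rewrite !scale_col_mx add_col_mx; congr col_mx; apply/matrixP => i k.
      by rewrite !mxE; ring.
    by rewrite !mxE ord1 (ord1 k) /= !mulr1n /GRing.scale /=; ring.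
  rewrite lin; apply: le_trans (enormD _ _) _; rewrite !enormZ //.
  have := ler_wpM2l t0 (cone j); have := ler_wpM2l s0 (cone' j).
  rewrite /GRing.scale /=; lra.
Qed.

End Equivalence.

Theorem theorem5 (R : realType) (Dx Dxi J M : nat)
    (X : set 'cV[R]_Dx) (Xi : set 'cV[R]_Dxi)
    (L : max_affine R Dx Dxi J)
    (P : probability (borel_cV R Dxi) R) (Omega eps : R)
    (z : 'I_M -> 'cV[R]_Dx) :
  (0 < M)%N ->
  compact X -> compact Xi ->
  P Xi = 1%E ->
  ('E_P[fun xi : 'cV[R]_Dxi => (enorm xi ^+ 2)%R] < Omega%:E)%E ->
  0 <= eps ->
  (forall m, X (z m)) ->
  convex_set (X : set (convex_lmodType 'cV[R]_Dx)) ->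
  convex_set (Xi : set (convex_lmodType 'cV[R]_Dxi)) ->
  equivalent_by_completion
    (semi_infinite_program X Xi L P Omega eps z)
    (finite_program X Xi L P Omega eps z)
  /\ convex_program (finite_program X Xi L P Omega eps z).
Proof.
move=> _ _ kXi PXi _ _ _ cX cXi.
(* P would otherwise vanish on Xi. *)
have Xi0 : Xi !=set0.
  apply/set0P/negP => /eqP Xi0; move: PXi; rewrite Xi0 measure0 => /eqP.
  by rewrite eq_sym onee_eq0.
split; last exact: finite_program_convex.
by split=> // v; exact: feasible_completion.
Qed.
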